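(* Let $d\geq 1$. (i) A function $f:\mathbb{Z}_+^d\to\mathbb{R}$ is positive definite if and only if \[ (f*_d\mu_d)(i_1,\ldots,i_d)\geq 0\quad\text{for all }i_1,\ldots,i_d\in\mathbb{Z}_+. \] (ii) Let $f:\mathbb{Z}_+^d\to\mathbb{R}$ be of the form $f(x_1,x_2,\ldots,x_d)=g_1(x_1)g_2(x_2)\cdots g_d(x_d)$ with functions $g_1,\ldots,g_d:\mathbb{Z}_+\to\mathbb{R}$. Then $f$ is positive definite if and only if there exists $\mathcal{I}\subset\{1,\ldots,d\}$, with $\#\mathcal{I}$ even, such that \[ (g_i*_1\mu)(j)\leq 0\quad\text{for all }i\in\mathcal{I}\text{ and }j\in\mathbb{Z}_+ \] and \[ (g_i*_1\mu)(j)\geq 0\quad\text{for all }i\in\{1,\ldots,d\}\setminus\mathcal{I}\text{ and }j\in\mathbb{Z}_+. \]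
   Context: $\mathbb{Z}_+$ is the set of positive integers. For $\boldsymbol{x}=(x_1,\ldots,x_d)$ and $\boldsymbol{y}=(y_1,\ldots,y_d)$ in $\mathbb{Z}_+^d$ put $(\boldsymbol{x},\boldsymbol{y})_d=(\gcd(x_1,y_1),\ldots,\gcd(x_d,y_d))$. A function $f:\mathbb{Z}_+^d\to\mathbb{R}$ is called positive definite if the matrix $(f((\boldsymbol{x},\boldsymbol{y})_d))_{\boldsymbol{x}\in S,\boldsymbol{y}\in S}$ is positive semidefinite for every finite nonempty $S\subset\mathbb{Z}_+^d$. The Dirichlet convolution of $f,g:\mathbb{Z}_+^d\to\mathbb{R}$ is \[ (f*_dg)(i_1,\ldots,i_d)=\sum_{k_1|i_1,\ldots,k_d|i_d}f(k_1,\ldots,k_d)\,g\Big(\frac{i_1}{k_1},\ldots,\frac{i_d}{k_d}\Big); \] in particular $*_1$ is the usual Dirichlet convolution. $\mu$ is the classical arithmetic Möbius function, and $\mu_d(i_1,\ldots,i_d)=\mu(i_1)\cdots\mu(i_d)$.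
   Formalization: In (ii), ''positive definite implies the sign pattern exists'' is stated only for f not identically zero; as printed it fails, e.g. d=2, g_1=0, g_2 the indicator of {1}, where f=0 is positive definite but g_2*μ=μ changes sign. *)

(* Defs.v *)
From mathcomp Require Import all_boot all_order all_algebra finmap.
From mathcomp Require Import boolp classical_sets fsbigop reals.

Set Implicit Arguments.
Unset Strict Implicit.
Unset Printing Implicit Defensive.

Import Order.TTheory GRing.Theory Num.Theory.
Local Open Scope classical_set_scope.
Local Open Scope ring_scope.

Notation Zpos := {n : nat | (0 < n)%N}.

Definition Zpos1 : Zpos := Sub 1%N isT.

Lemma gcdZ_gt0 (x y : Zpos) : (0 < gcdn (val x) (val y))%N.
Proof. by rewrite gcdn_gt0 (valP x). Qed.

Definition gcdZ (x y : Zpos) : Zpos := Sub (gcdn (val x) (val y)) (gcdZ_gt0 x y).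

Definition dvdZ (k n : Zpos) : bool := (val k %| val n)%N.

(* The default value is only returned when val n < val k, so never for k | n. *)
Definition divZ (n k : Zpos) : Zpos := insubd Zpos1 (val n %/ val k)%N.

Notation Zvec d := {ffun 'I_d -> Zpos}.

Definition gcdV (d : nat) (x y : Zvec d) : Zvec d := [ffun i => gcdZ (x i) (y i)].

Definition divV (d : nat) (n k : Zvec d) : Zvec d := [ffun i => divZ (n i) (k i)].

Definition psdmx (R : realType) (n : nat) (A : 'M[R]_n) : Prop :=
  A^T = A /\ forall v : 'cV[R]_n, 0 <= (v^T *m A *m v) 0 0.

(* Rows and columns are indexed by S through its canonical enumeration. *)
Definition gcdmx (R : realType) (d : nat) (f : Zvec d -> R) (S : {fset Zvec d}) :
    'M[R]_#|{: S}| :=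
  \matrix_(i, j) f (gcdV (val (enum_val i)) (val (enum_val j))).

Definition positive_definite (R : realType) (d : nat) (f : Zvec d -> R) : Prop :=
  forall S : {fset Zvec d}, S != fset0 -> psdmx (gcdmx f S).

(* A sum over \in ranges over the support of the summand, and is 0 if that is
   infinite; the divisors of a given n form a finite set. *)
Definition dconv (R : realType) (d : nat) (f g : Zvec d -> R) (n : Zvec d) : R :=
  \sum_(k \in [set k : Zvec d | forall i, dvdZ (k i) (n i)]) (f k * g (divV n k)).

Definition dconv1 (R : realType) (f g : Zpos -> R) (n : Zpos) : R :=
  \sum_(k \in [set k : Zpos | dvdZ k n]) (f k * g (divZ n k)).

Definition moebius (R : realType) (n : Zpos) : R :=
  if all (fun p => logn p (val n) == 1%N) (primes (val n))
  then (-1) ^+ size (primes (val n)) else 0.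

Definition moebiusV (R : realType) (d : nat) (n : Zvec d) : R :=
  \prod_(i < d) moebius R (n i).

Definition even_sign_pattern (R : realType) (d : nat) (g : 'I_d -> Zpos -> R) : Prop :=
  exists I : {set 'I_d},
    [/\ ~~ odd #|I|,
        forall (i : 'I_d) (j : Zpos), i \in I -> dconv1 (g i) (moebius R) j <= 0
      & forall (i : 'I_d) (j : Zpos), i \notin I -> 0 <= dconv1 (g i) (moebius R) j].

(* Main.v *)
(** Put [h = f *_d mu_d], so that [f n] is the sum of [h k] over [k | n] by
    Moebius inversion.  Since [k | gcd(x, y)] iff [k | x] and [k | y], the
    quadratic form of [f] at a vector [v] is the sum over [k] of
    [h k * (sum of v_x over the x divisible by k)^2], which gives one
    direction of (i).  Conversely, taking [v_x = mu_d(n / x)] for [x | n] and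
    [v_x = 0] otherwise turns the inner sums into the indicator of [k = n], and
    the form into [h n].

    For (ii), [h n] is the product of the [h_i n_i] with [h_i = g_i * mu].  If
    [f] is not zero then [h m <> 0] for some [m]; varying one coordinate of [m]
    at a time shows that every [h_i] has the constant sign of [h_i m_i], and
    [0 < h m] makes the number of negative signs even. *)
Require Import Defs.
From mathcomp Require Import all_boot all_order all_algebra finmap.
From mathcomp Require Import boolp classical_sets fsbigop reals.
Local Open Scope ring_scope.
Set Implicit Arguments.
Unset Strict Implicit.
Unset Printing Implicit Defensive.
Import Order.TTheory GRing.Theory Num.Theory.

(** * Moebius sums over positive integers *)

(** [moebius R n] unfolds to [mu R (val n)]; on [nat], products and quotients need no positivity
    proofs. *)
Definition mu (R : realType) (n : nat) : R :=
  if all (fun p => logn p n == 1%N) (primes n) then (-1) ^+ size (primes n) else 0.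

(** If [p] divides [n], its exponent in [p * n] exceeds 1; otherwise [p] is one new simple prime
    factor, which flips the sign. *)
Lemma mu_primeM (R : realType) (p n : nat) : prime p -> (0 < n)%N ->
  mu R (p * n) = if (p %| n)%N then 0 else - mu R n.
Proof.
move=> p_pr n_gt0; have p_gt0 := prime_gt0 p_pr.
have pn_gt0 : (0 < p * n)%N by rewrite muln_gt0 p_gt0.
rewrite /mu; have [p_n|p'n] := boolP (p %| n)%N.
  suff /negbTE -> : ~~ all (fun q => logn q (p * n) == 1%N) (primes (p * n)) by [].
  apply/allPn; exists p; first by rewrite mem_primes p_pr pn_gt0 dvdn_mulr.
  rewrite lognM // logn_prime // eqxx add1n eqSS -lt0n.
  by rewrite -(@pfactor_dvdn p 1) // expn1.
have Epr : perm_eq (primes (p * n)) (p :: primes n).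
  apply: uniq_perm; rewrite /= ?primes_uniq ?mem_primes ?(negbTE p'n) ?andbF //.
  by move=> q; rewrite inE primesM // primes_prime // inE.
rewrite (perm_all _ Epr) (perm_size Epr) /= lognM // logn_prime // eqxx.
rewrite lognE (negbTE p'n) !andbF addn0 eqxx /=.
rewrite (@eq_in_all _ _ (fun q => logn q n == 1%N)); last first.
  move=> q /=; rewrite mem_primes => /and3P[q_pr _ q_n].
  by rewrite lognM // logn_prime //; case: (eqVneq q p) q_n p'n => [-> ->|].
by case: ifP => _; rewrite ?oppr0 // exprS mulN1r.
Qed.

(* Pairing [e] with [p * e] for a prime [p | n]: the divisors [p * e] with
   [p | e] are not squarefree, the others cancel. *)
Lemma sum_mu_divisors (R : realType) (n : nat) : (0 < n)%N ->
  \sum_(e <- divisors n) mu R e = (n == 1%N)%:R.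
Proof.
move=> n_gt0; have [->|n_neq1] := eqVneq n 1%N.
  by rewrite (_ : divisors 1 = [:: 1%N]) // big_seq1 /mu /= expr0.
have n_gt1 : (1 < n)%N by case: n n_gt0 n_neq1 => [|[]].
set p := pdiv n; have p_pr : prime p by apply: pdiv_prime.
have p_n : (p %| n)%N by apply: pdiv_dvd.
have p_gt0 := prime_gt0 p_pr.
have np_gt0 : (0 < n %/ p)%N by rewrite divn_gt0 // dvdn_leq.
rewrite (bigID (fun e => p %| e)%N) /= -big_filter.
have E1 : perm_eq [seq e <- divisors n | (p %| e)%N]
                  [seq (p * e)%N | e <- divisors (n %/ p)].
  apply: uniq_perm; rewrite ?filter_uniq ?divisors_uniq //.
    rewrite map_inj_uniq ?divisors_uniq // => a b /eqP.
    by rewrite eqn_pmul2l // => /eqP.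
  move=> e; rewrite mem_filter -dvdn_divisors //; apply/andP/mapP.
    move=> [/dvdnP[a ->] a_n]; exists a; last by rewrite mulnC.
    by rewrite -dvdn_divisors // dvdn_divRL.
  move=> [a]; rewrite -dvdn_divisors // dvdn_divRL // mulnC => a_n ->.
  by rewrite dvdn_mulr.
rewrite (perm_big _ E1) /= big_map.
rewrite (_ : \sum_(e <- divisors (n %/ p)) mu R (p * e) =
   - \sum_(e <- divisors (n %/ p) | ~~ (p %| e)%N) mu R e); last first.
  rewrite -sumrN [RHS]big_mkcond /= big_seq [RHS]big_seq; apply: eq_bigr => e.
  rewrite -dvdn_divisors // => /dvdn_gt0 e_gt0; rewrite mu_primeM ?e_gt0 //.
  by case: ifP.
(* The divisors prime to [p] are the same for [n] and [n %/ p]: if such an [e] divides [n], so does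
   [p * e]. *)
apply/eqP; rewrite addrC subr_eq0; apply/eqP; rewrite -big_filter -[RHS]big_filter.
apply: perm_big; apply: uniq_perm; rewrite ?filter_uniq ?divisors_uniq // => e.
rewrite !mem_filter -!dvdn_divisors // dvdn_divRL //.
have [//|p'e /=] := boolP (p %| e)%N.
by rewrite Gauss_dvd ?p_n ?andbT // coprime_sym prime_coprime.
Qed.

(** An index [j < N] stands for the integer [j.+1]; this passes from such indices to an explicit
    list of divisors. *)
Lemma sum_ord_seq (R : realType) (N : nat) (P : pred nat) (s : seq nat) (F : nat -> R) :
  uniq s -> (forall j, (j \in s) = [&& (0 < j)%N, (j <= N)%N & P j]) ->
  \sum_(j < N | P j.+1) F j.+1 = \sum_(j <- s) F j.
Proof.
move=> s_uniq sE; rewrite -(big_mkord (fun j => P j.+1) (fun j => F j.+1)).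
rewrite -(big_map S P F) -big_filter; apply: perm_big; apply: uniq_perm => //.
  by rewrite filter_uniq // map_inj_uniq ?iota_uniq // => a b [].
move=> j; rewrite mem_filter sE andbC andbA; congr (_ && _).
case: j => [|j]; first by apply/negbTE/mapP => -[].
by rewrite mem_map ?mem_index_iota // => a b [].
Qed.

(** Writing [j = k * e] lets [e] run over the divisors of [n %/ k]; unless [k] divides [n], the
    range is empty. *)
Lemma sum_mu_interval_l (R : realType) (N k n : nat) :
  (0 < k)%N -> (0 < n)%N -> (n <= N)%N ->
  \sum_(j < N | (k %| j.+1)%N && (j.+1 %| n)%N) mu R (j.+1 %/ k) = (k == n)%:R.
Proof.
move=> k_gt0 n_gt0 n_le; have [k_n|k'n] := boolP (k %| n)%N; last first.
  rewrite big1 => [|j /andP[kj /(dvdn_trans kj)]]; last by rewrite (negbTE k'n).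
  by case: eqP k'n => // ->; rewrite dvdnn.
have nk_gt0 : (0 < n %/ k)%N by rewrite divn_gt0 // dvdn_leq.
rewrite (@sum_ord_seq R N (fun j => (k %| j)%N && (j %| n)%N)
  [seq (k * e)%N | e <- divisors (n %/ k)] (fun j => mu R (j %/ k))).
- rewrite big_map (eq_bigr (mu R)) => [|e _]; last by rewrite mulKn.
  by rewrite sum_mu_divisors // -(eqn_pmul2r k_gt0) divnK // mul1n eq_sym.
- rewrite map_inj_uniq ?divisors_uniq // => a b /eqP.
  by rewrite eqn_pmul2l // => /eqP.
move=> j; apply/mapP/and4P => [[e]|[j_gt0 _ /dvdnP[e ->]]].
  rewrite -dvdn_divisors // dvdn_divRL // mulnC => e_n ->.
  have := dvdn_gt0 n_gt0 e_n => ke_gt0.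
  by rewrite ke_gt0 dvdn_mulr // e_n (leq_trans (dvdn_leq _ e_n)).
by exists e; rewrite 1?mulnC // -dvdn_divisors // dvdn_divRL // mulnC.
Qed.

(** Now [j = n %/ e], again with [e] over the divisors of [n %/ k]; this is injective as
    [n %/ (n %/ e) = e]. *)
Lemma sum_mu_interval_r (R : realType) (N k n : nat) :
  (0 < k)%N -> (0 < n)%N -> (n <= N)%N ->
  \sum_(j < N | (k %| j.+1)%N && (j.+1 %| n)%N) mu R (n %/ j.+1) = (k == n)%:R.
Proof.
move=> k_gt0 n_gt0 n_le; have [k_n|k'n] := boolP (k %| n)%N; last first.
  rewrite big1 => [|j /andP[kj /(dvdn_trans kj)]]; last by rewrite (negbTE k'n).
  by case: eqP k'n => // ->; rewrite dvdnn.
have nk_gt0 : (0 < n %/ k)%N by rewrite divn_gt0 // dvdn_leq.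
have e_nk e : e \in divisors (n %/ k) -> [/\ (e * k %| n)%N, (e %| n)%N & (0 < e)%N].
  rewrite -dvdn_divisors // dvdn_divRL // => ek_n; split => //.
    exact: dvdn_trans (dvdn_mulr _ _) ek_n.
  by move: (dvdn_gt0 n_gt0 ek_n); rewrite muln_gt0 => /andP[].
have divnn e : (0 < e)%N -> (e %| n)%N -> (n %/ (n %/ e))%N = e.
  move=> e_gt0 e_n; rewrite -{1}(divnK e_n) mulKn //.
  by rewrite divn_gt0 // dvdn_leq.
rewrite (@sum_ord_seq R N (fun j => (k %| j)%N && (j %| n)%N)
  [seq (n %/ e)%N | e <- divisors (n %/ k)] (fun j => mu R (n %/ j))).
- rewrite big_map big_seq (eq_bigr (mu R)) => [|e /e_nk[_ e_n e_gt0]]; last by rewrite divnn.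
  by rewrite -big_seq sum_mu_divisors // -(eqn_pmul2r k_gt0) divnK // mul1n eq_sym.
- rewrite map_inj_in_uniq ?divisors_uniq // => a b /e_nk[_ an a0] /e_nk[_ bn b0] eab.
  by rewrite -[a]divnn // eab divnn.
move=> j; apply/mapP/and4P => [[e /e_nk[ek_n e_n e_gt0] ->]|[j_gt0 _ k_j j_n]].
  rewrite divn_gt0 // dvdn_leq // dvdn_divRL // mulnC ek_n dvdn_div //.
  by rewrite (leq_trans (leq_div _ _)).
exists (n %/ j)%N; last by rewrite divnn.
by rewrite -dvdn_divisors // dvdn_divRL // -{2}(divnK j_n) dvdn_mul.
Qed.

(** * Divisibility of vectors and finite boxes *)

Definition Zsucc (j : nat) : Zpos := Sub j.+1 isT.

(* Sums over divisors are computed inside the box [{1..N}^d], indexed by a finite type. *)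
Definition boxV (d N : nat) (t : {ffun 'I_d -> 'I_N}) : Zvec d := [ffun i => Zsucc (t i)].

Definition dvdV (d : nat) (k n : Zvec d) : bool := [forall i, dvdZ (k i) (n i)].

Lemma val_divZ (n k : Zpos) : dvdZ k n -> val (divZ n k) = (val n %/ val k)%N.
Proof.
move=> k_n; rewrite /divZ insubdK // -topredE /= divn_gt0 ?(valP k) //.
by rewrite dvdn_leq ?(valP n).
Qed.

Lemma dvdV_gcd (d : nat) (k x y : Zvec d) : dvdV k (gcdV x y) = dvdV k x && dvdV k y.
Proof.
apply/forallP/andP => [h|[/forallP hx /forallP hy] i].
  by split; apply/forallP => i; move: (h i); rewrite /dvdZ ffunE /= dvdn_gcd => /andP[].
by rewrite /dvdZ ffunE /= dvdn_gcd; apply/andP; split; [apply: hx | apply: hy].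
Qed.

Lemma Zsucc_inj (i j : nat) : Zsucc i = Zsucc j -> i = j.
Proof. by move/(congr1 val) => []. Qed.

Lemma boxV_inj (d N : nat) : injective (@boxV d N).
Proof.
move=> s t st; apply/ffunP => i; apply/val_inj/Zsucc_inj.
by have := congr1 (fun x : Zvec d => x i) st; rewrite !ffunE.
Qed.

Lemma boxV_le (d N : nat) (t : {ffun 'I_d -> 'I_N}) i : (val (boxV t i) <= N)%N.
Proof. by rewrite ffunE /= ltn_ord. Qed.

Lemma boxVP (d N : nat) (n : Zvec d) :
  (forall i, val (n i) <= N)%N -> exists t : {ffun 'I_d -> 'I_N}, n = boxV t.
Proof.
move=> n_le; have lt i : ((val (n i)).-1 < N)%N by rewrite prednK ?n_le ?(valP (n i)).
exists [ffun i => Ordinal (lt i)]; apply/ffunP => i; apply/val_inj.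
by rewrite !ffunE /= prednK // (valP (n i)).
Qed.

Lemma box_bound (d : nat) (s : seq (Zvec d)) :
  exists N, forall n, n \in s -> forall i, (val (n i) <= N)%N.
Proof.
exists (\max_(n <- s) \max_i val (n i)) => n n_s i.
exact: leq_trans (leq_bigmax i) (@leq_bigmax_seq _ s xpredT _ n n_s isT).
Qed.

Lemma dvdV_le (d N : nat) (k n : Zvec d) :
  dvdV k n -> (forall i, val (n i) <= N)%N -> forall i, (val (k i) <= N)%N.
Proof.
move=> /forallP k_n n_le i; apply: leq_trans (n_le i).
by apply: dvdn_leq (k_n i); apply: valP (n i).
Qed.

(** All divisors of [n] lie in the box, so the list [s] enumerates exactly the index set of the
    convolution. *)
Lemma dconv_box (R : realType) (d N : nat) (f g : Zvec d -> R) (n : Zvec d) :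
  (forall i, val (n i) <= N)%N ->
  dconv f g n =
  \sum_(t : {ffun 'I_d -> 'I_N} | dvdV (boxV t) n) f (boxV t) * g (divV n (boxV t)).
Proof.
move=> n_le; set s := [seq boxV t | t <- enum [pred t : {ffun 'I_d -> 'I_N} | dvdV (boxV t) n]].
transitivity (\sum_(k <- s) f k * g (divV n k)); last by rewrite big_map big_enum.
rewrite fsbig_seq; last by rewrite map_inj_uniq ?enum_uniq //; exact: boxV_inj.
rewrite /dconv; apply: eq_fsbigl; apply/seteqP; split => k /=.
  move=> /forallP k_n; apply/mapP; have [t kt] := boxVP (dvdV_le k_n n_le).
  by exists t; rewrite // mem_enum inE -kt.
by move=> /mapP[t]; rewrite mem_enum => /forallP t_n ->.
Qed.

Lemma dconv1_box (R : realType) (N : nat) (f g : Zpos -> R) (n : Zpos) :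
  (val n <= N)%N ->
  dconv1 f g n = \sum_(j < N | dvdZ (Zsucc j) n) f (Zsucc j) * g (divZ n (Zsucc j)).
Proof.
move=> n_le; set s := [seq Zsucc j | j : 'I_N <- enum [pred j : 'I_N | dvdZ (Zsucc j) n]].
transitivity (\sum_(k <- s) f k * g (divZ n k)); last by rewrite big_map big_enum.
rewrite fsbig_seq; last first.
  by rewrite map_inj_uniq ?enum_uniq // => i j /Zsucc_inj/val_inj.
rewrite /dconv1; apply: eq_fsbigl; apply/seteqP; split => k /=.
  move=> k_n; have k_lt : ((val k).-1 < N)%N.
    by rewrite prednK ?(valP k) // (leq_trans _ n_le) // dvdn_leq ?(valP n).
  have kE : k = Zsucc (Ordinal k_lt) by apply/val_inj; rewrite /= prednK ?(valP k).
  by apply/mapP; exists (Ordinal k_lt); rewrite // mem_enum inE -kE.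
by move=> /mapP[t]; rewrite mem_enum => t_n ->.
Qed.

(** * Moebius inversion in several variables *)

Lemma prod_indicator (R : realType) (d : nat) (b : 'I_d -> bool) :
  \prod_(i < d) (b i)%:R = [forall i, b i]%:R :> R.
Proof.
case: forallP => [bT|/forallP]; first by rewrite big1 // => i _; rewrite bT.
by rewrite negb_forall => /existsP[i /negbTE bi]; rewrite (bigD1 i) //= bi mul0r.
Qed.

Lemma eqZvecE (d : nat) (k n : Zvec d) : (k == n) = [forall i, val (k i) == val (n i)].
Proof.
apply/eqP/forallP => [-> //|kn]; apply/ffunP => i; exact/val_inj/eqP.
Qed.

(** The indicator of [k = n] is a product over coordinates; each factor is a one-variable interval
    sum, and distributing the product over these sums gives a sum over the box. *)
Lemma sum_muV_interval_l (R : realType) (d N : nat) (k n : Zvec d) :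
  (forall i, val (n i) <= N)%N ->
  \sum_(t : {ffun 'I_d -> 'I_N} | dvdV k (boxV t) && dvdV (boxV t) n)
     moebiusV R (divV (boxV t) k) = (k == n)%:R.
Proof.
move=> n_le; rewrite eqZvecE -prod_indicator.
under [RHS]eq_bigr => i _ do rewrite
  -(sum_mu_interval_l R (valP (k i)) (valP (n i)) (n_le i)).
rewrite bigA_distr_big_dep; apply: eq_big => [t|t /andP[/forallP k_t _]].
  apply/andP/familyP => [[/forallP kt /forallP tn] i|h].
    by move: (kt i) (tn i); rewrite /dvdZ !ffunE unfold_in /= => -> ->.
  by split; apply/forallP => i; move: (h i); rewrite /dvdZ ffunE unfold_in /= => /andP[].
apply: eq_bigr => i _; rewrite /moebius -/(mu R _) ffunE val_divZ; last exact: k_t.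
by rewrite ffunE.
Qed.

(** Proved by the same distribution; evaluates the test vector used for necessity in (i). *)
Lemma sum_muV_interval_r (R : realType) (d N : nat) (k n : Zvec d) :
  (forall i, val (n i) <= N)%N ->
  \sum_(t : {ffun 'I_d -> 'I_N} | dvdV k (boxV t) && dvdV (boxV t) n)
     moebiusV R (divV n (boxV t)) = (k == n)%:R.
Proof.
move=> n_le; rewrite eqZvecE -prod_indicator.
under [RHS]eq_bigr => i _ do rewrite
  -(sum_mu_interval_r R (valP (k i)) (valP (n i)) (n_le i)).
rewrite bigA_distr_big_dep; apply: eq_big => [t|t /andP[_ /forallP t_n]].
  apply/andP/familyP => [[/forallP kt /forallP tn] i|h].
    by move: (kt i) (tn i); rewrite /dvdZ !ffunE unfold_in /= => -> ->.
  by split; apply/forallP => i; move: (h i); rewrite /dvdZ ffunE unfold_in /= => /andP[].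
apply: eq_bigr => i _; rewrite /moebius -/(mu R _) ffunE val_divZ; last exact: t_n.
by rewrite ffunE.
Qed.

Lemma sum_box_delta (R : realType) (d N : nat) (F : Zvec d -> R) (n : Zvec d) :
  (forall i, val (n i) <= N)%N ->
  \sum_(t : {ffun 'I_d -> 'I_N}) F (boxV t) * (boxV t == n)%:R = F n.
Proof.
move=> /boxVP[t0 ->]; rewrite (bigD1 t0) //= eqxx mulr1 big1 ?addr0 // => t t_neq.
by rewrite (inj_eq (@boxV_inj d N)) (negbTE t_neq) mulr0.
Qed.

(** After exchanging sums, [f s] carries the sum of [mu_d(t / s)] over [s | t | n], which is 1 if
    [s = n] and 0 otherwise. *)
Lemma moebius_inversion (R : realType) (d N : nat) (f : Zvec d -> R) (n : Zvec d) :
  (forall i, val (n i) <= N)%N ->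
  f n = \sum_(t : {ffun 'I_d -> 'I_N} | dvdV (boxV t) n) dconv f (@moebiusV R d) (boxV t).
Proof.
move=> n_le; under eq_bigr => t _ do rewrite (dconv_box f _ (boxV_le t)).
rewrite (exchange_big_dep xpredT) //= -(sum_box_delta f n_le); apply: eq_bigr => s _.
rewrite -(sum_muV_interval_l R _ n_le) mulr_sumr.
by apply: eq_bigl => t; rewrite andbC.
Qed.

(** * The quadratic form of a gcd matrix, and part (i) *)

Lemma gcdmx_quadE (R : realType) (d N : nat) (f : Zvec d -> R) (S : {fset Zvec d})
    (v : 'cV[R]_#|{: S}|) :
  (forall x, x \in S -> forall i, (val (x i) <= N)%N) ->
  (v^T *m gcdmx f S *m v) 0 0 =
  \sum_(t : {ffun 'I_d -> 'I_N}) dconv f (@moebiusV R d) (boxV t) *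
     (\sum_(i | dvdV (boxV t) (val (enum_val i))) v i 0) ^+ 2.
Proof.
move=> S_le; set h := dconv f _; pose x (i : 'I_#|{: S}|) : Zvec d := val (enum_val i).
have fE i j : f (gcdV (x i) (x j)) =
    \sum_(t : {ffun 'I_d -> 'I_N} | dvdV (boxV t) (x i) && dvdV (boxV t) (x j)) h (boxV t).
  rewrite (@moebius_inversion _ _ N) => [|l].
    by apply: eq_bigl => t; rewrite dvdV_gcd.
  apply: leq_trans (S_le _ (valP (enum_val i)) l).
  by rewrite ffunE /= dvdn_leq ?(valP (x i l)) ?dvdn_gcdl.
(* Each entry is expanded over [t] by [fE], and two exchanges bring [t] outermost. *)
rewrite mxE; under eq_bigr => j _.
  rewrite mxE mulr_suml; under eq_bigr => i _.
    rewrite !mxE -/(x i) -/(x j) fE big_mkcond mulr_sumr mulr_suml.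
    over.
  rewrite exchange_big /=.
  over.
rewrite exchange_big /=; apply: eq_bigr => t _.
rewrite expr2 big_distrlr /= mulr_sumr [RHS]big_mkcond exchange_big /=; apply: eq_bigr => i _.
rewrite -/(x i); case: ifP => t_i; last first.
  by rewrite big1 // => j _; rewrite /= mulr0 mul0r.
rewrite mulr_sumr [RHS]big_mkcond; apply: eq_bigr => j _ /=; rewrite -/(x j).
by case: ifP => _; rewrite ?mulr0 ?mul0r // mulrA [h _ * _]mulrC.
Qed.

Lemma sum_enum_val_fset (R : realType) (K : choiceType) (S : {fset K}) (P : pred K) (F : K -> R) :
  \sum_(i < #|{: S}| | P (val (enum_val i))) F (val (enum_val i)) = \sum_(x <- S | P x) F x.
Proof.
rewrite big_seq_fsetE /= [RHS]big_mkcond [LHS]big_mkcond /=.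
by rewrite -(big_enum_val (fun x : S => if P (val x) then F (val x) else 0)).
Qed.

Lemma positive_definiteP (R : realType) (d : nat) (f : Zvec d -> R) :
  positive_definite f <-> forall n, 0 <= dconv f (@moebiusV R d) n.
Proof.
split=> [f_pd n|h_ge0 S _]; last first.
  split.
    apply/matrixP => i j; rewrite !mxE; congr f.
    by apply/ffunP => l; rewrite !ffunE; apply/val_inj; rewrite /= gcdnC.
  move=> v; have [N S_le] := box_bound (enum_fset S).
  by rewrite (gcdmx_quadE f v S_le) sumr_ge0 // => t _; rewrite mulr_ge0 ?sqr_ge0.
have [N n_leN] := box_bound [:: n]; have n_le := n_leN n (mem_head _ _).
(* The whole box serves as [S]: [v] below vanishes off the divisors of [n], so its sums become those
   of [sum_muV_interval_r]. *)
pose S : {fset Zvec d} := [fset boxV t | t in {: {ffun 'I_d -> 'I_N}}]%fset.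
have S_le x : x \in S -> forall i, (val (x i) <= N)%N.
  by move=> /imfsetP[t _ ->]; apply: boxV_le.
have S_neq0 : S != fset0.
  by have [t nt] := boxVP n_le; apply/fset0Pn; exists n; apply/imfsetP; exists t.
pose v : 'cV[R]_#|{: S}| := \col_i
  (if dvdV (val (enum_val i)) n then moebiusV R (divV n (val (enum_val i))) else 0).
have [_ /(_ v)] := f_pd S S_neq0; rewrite (gcdmx_quadE f v S_le).
suff vE (t : {ffun 'I_d -> 'I_N}) :
    \sum_(i | dvdV (boxV t) (val (enum_val i))) v i 0 = (boxV t == n)%:R.
  have sqr_bool (b : bool) : b%:R ^+ 2 = b%:R :> R by case: b; rewrite ?expr1n ?expr0n.
  under eq_bigr => t _ do rewrite vE sqr_bool.
  by rewrite sum_box_delta.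
rewrite -(sum_muV_interval_r R _ n_le) [RHS]big_mkcondr /=.
under eq_bigr => i _ do rewrite mxE.
rewrite (sum_enum_val_fset S (dvdV (boxV t))
  (fun x => if dvdV x n then moebiusV R (divV n x) else 0)).
rewrite big_mkcond /= big_imfset /=; last by move=> ? ? _ _; apply: boxV_inj.
by rewrite big_enum /= -big_mkcond.
Qed.

(** * Product functions, and part (ii) *)

Lemma prod_sign (R : realType) (I : finType) (A : {set I}) (a : I -> R) :
  (forall i, i \in A -> a i <= 0) -> (forall i, i \notin A -> 0 <= a i) ->
  \prod_i a i = (-1) ^+ #|A| * \prod_i `|a i|.
Proof.
move=> aN aP; rewrite -sum1_card [X in _ ^+ X]big_mkcond -prodrXr -big_split /=.
apply: eq_bigr => i _; case: ifPn => iA; first by rewrite ler0_norm ?aN // expr1 mulN1r opprK.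
by rewrite ger0_norm ?aP // expr0 mul1r.
Qed.

(** A divisor of [n] is an independent choice of a divisor in each coordinate, so the sum of
    products factors. *)
Lemma dconv_prod (R : realType) (d : nat) (f : Zvec d -> R) (g : 'I_d -> Zpos -> R) :
  (forall x, f x = \prod_(i < d) g i (x i)) ->
  forall n, dconv f (@moebiusV R d) n = \prod_(i < d) dconv1 (g i) (moebius R) (n i).
Proof.
move=> fE n; have [N n_leN] := box_bound [:: n]; have n_le := n_leN n (mem_head _ _).
rewrite (dconv_box _ _ n_le); under [RHS]eq_bigr => i _ do rewrite (dconv1_box _ _ (n_le i)).
rewrite bigA_distr_big_dep; apply: eq_big => [t|t _].
  by apply/forallP/familyP => h i; move: (h i); rewrite ffunE.
by rewrite fE /moebiusV -big_split; apply: eq_bigr => i _; rewrite /= !ffunE.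
Qed.

(** In (ii), necessity is stated for nonzero [f]: if one [g i] is zero, then [f = 0] is positive
    definite whatever the signs of the other factors. *)
Theorem theorem4p3 (R : realType) (d : nat) (d_ge1 : (1 <= d)%N) :
  (forall f : Zvec d -> R,
     positive_definite f <-> (forall n : Zvec d, 0 <= dconv f (@moebiusV R d) n))
  /\
  (forall (f : Zvec d -> R) (g : 'I_d -> Zpos -> R),
     (forall x : Zvec d, f x = \prod_(i < d) g i (x i)) ->
     (even_sign_pattern g -> positive_definite f)
     /\
     ((exists x : Zvec d, f x <> 0) -> positive_definite f -> even_sign_pattern g)).
Proof.
split=> [f|f g /dconv_prod hE]; first exact: positive_definiteP.
split=> [[I [I_even hN hP]]|[x /eqP fx_neq0] /positive_definiteP h_ge0].
  apply/positive_definiteP => n; rewrite hE (@prod_sign _ _ I).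
  - by rewrite -signr_odd (negbTE I_even) mul1r prodr_ge0.
  - by move=> i iI; apply: hN.
  - by move=> i iI; apply: hP.
set h := fun i => dconv1 (g i) (moebius R).
(* If the convolution vanished everywhere, inversion would give [f x = 0]. *)
have [m hm_neq0] : exists m, dconv f (@moebiusV R d) m != 0.
  have [N x_leN] := box_bound [:: x]; have x_le := x_leN x (mem_head _ _).
  apply: contrapT => h0; case/eqP: fx_neq0; rewrite (moebius_inversion f x_le).
  rewrite big1 // => t _; apply/eqP/negPn/negP => ht; apply: h0; by exists (boxV t).
have hm_gt0 : 0 < \prod_i h i (m i) by rewrite -hE lt_def hm_neq0 h_ge0.
exists [set i | h i (m i) < 0].
have same i j : 0 <= h i j * h i (m i).
  (* Changing coordinate [i] of [m] to [j] leaves the cofactor [Q], so the product of the two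
     convolution values is [h i j * h i (m i) * Q ^+ 2], with [Q] nonzero. *)
  pose m' : Zvec d := [ffun l => if l == i then j else m l].
  pose Q := \prod_(l | l != i) h l (m l).
  have m'E : dconv f (@moebiusV R d) m' = h i j * Q.
    rewrite hE (bigD1 i) //= ffunE eqxx; congr (_ * _).
    by apply: eq_bigr => l /negbTE l_i; rewrite ffunE l_i.
  have mE : \prod_l h l (m l) = h i (m i) * Q by rewrite (bigD1 i).
  have := mulr_ge0 (h_ge0 m') (ltW hm_gt0); rewrite m'E mE mulrACA -expr2.
  rewrite pmulr_lge0 // exprn_even_gt0 //=.
  by apply: contraNneq (lt0r_neq0 hm_gt0) => Q0; rewrite mE Q0 mulr0.
split=> [|i j|i j].
- apply/negP => I_odd; move: hm_gt0.
  rewrite (@prod_sign _ _ [set i | h i (m i) < 0]) => [|i|i]; last 2 first.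
  + by rewrite inE => /ltW.
  + by rewrite inE -leNgt.
  by rewrite -signr_odd I_odd mulN1r oppr_gt0 ltNge prodr_ge0.
- by rewrite inE => hi; have := same i j; rewrite nmulr_lge0.
(* Off the set, [h i (m i)] is nonnegative; it cannot be 0, as it is a factor of the positive
   product [hm_gt0]. *)
rewrite inE -leNgt le_eqVlt => /predU1P[hi0|hi]; last by have := same i j; rewrite pmulr_lge0.
by move: hm_gt0; rewrite (bigD1 i) //= -hi0 mul0r ltxx.
Qed.
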